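(* For all integers $n>3$ such that $n\ne 5$, and for all integers $d\ge 4$, there exists a $d$-dimensional lattice polytope $P$ contained in $\mathbb{R}^d$ with $n2^{d-2}$ vertices such that no point of the lattice $\mathbb{Z}^d$ can be inserted in $P$.
   Context: A lattice polytope in $\mathbb{R}^d$ is a polytope whose vertices all belong to $\mathbb{Z}^d$. A point $x\in\mathbb{R}^d\setminus P$ can be inserted in a $d$-dimensional polytope $P\subset\mathbb{R}^d$ with vertex set $\mathcal{V}$ if the vertex set of the convex hull of $P\cup\{x\}$ is exactly $\mathcal{V}\cup\{x\}$ (points of $P$ itself are never insertable). *)

(* Defs.v *)
From mathcomp Require Import all_boot all_order all_algebra.
From mathcomp Require Import boolp classical_sets cardinality reals convex.

Set Implicit Arguments.
Unset Strict Implicit.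
Unset Printing Implicit Defensive.

Import Order.TTheory GRing.Theory Num.Theory.

Local Open Scope classical_set_scope.
Local Open Scope ring_scope.

Definition convex_hull (R : realType) (d : nat) (A : set 'rV[R]_d) :
    set 'rV[R]_d :=
  smallest (@convex_set R 'rV[R]_d) A.

Definition polytope (R : realType) (d : nat) (P : set 'rV[R]_d) : Prop :=
  exists2 S : set 'rV[R]_d, finite_set S & P = convex_hull S.

Definition dotrv (R : realType) (d : nat) (x y : 'rV[R]_d) : R :=
  \sum_(j < d) x 0 j * y 0 j.

(* Vertices are the zero-dimensional faces: [set v] is the set of maximizers
   over P of some linear functional dotrv c. *)
Definition vertices (R : realType) (d : nat) (P : set 'rV[R]_d) :
    set 'rV[R]_d :=
  [set v | P v /\ exists c : 'rV[R]_d,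
     forall y, P y -> y <> v -> dotrv c y < dotrv c v].

Definition lattice_point (R : realType) (d : nat) (x : 'rV[R]_d) : Prop :=
  forall j : 'I_d, x 0 j \is a Num.int.

Definition lattice_polytope (R : realType) (d : nat) (P : set 'rV[R]_d) :
    Prop :=
  polytope P /\ (forall v, vertices P v -> lattice_point v).

Definition affinely_independent (R : realType) (d k : nat)
    (p : 'I_k.+1 -> 'rV[R]_d) : bool :=
  row_free (\matrix_(i < k) (p (lift ord0 i) - p ord0)).

(* [affine_dim P k]: the affine hull of P has dimension k, i.e. k + 1 is the
   largest number of affinely independent points of P.  It holds for no k when
   P is empty. *)
Definition affine_dim (R : realType) (d : nat) (P : set 'rV[R]_d) (k : nat) :
    Prop :=
  (exists2 p : 'I_k.+1 -> 'rV[R]_d,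
     forall i, P (p i) & affinely_independent p) /\
  (forall (l : nat) (p : 'I_l.+1 -> 'rV[R]_d),
     (forall i, P (p i)) -> affinely_independent p -> (l <= k)%N).

Definition insertable (R : realType) (d : nat) (P : set 'rV[R]_d)
    (x : 'rV[R]_d) : Prop :=
  ~ P x /\ vertices (convex_hull (P `|` [set x])) = vertices P `|` [set x].

(* Main.v *)
Require Import Defs.
From mathcomp Require Import all_boot all_order all_algebra.
From mathcomp Require Import boolp classical_sets cardinality reals convex.
From mathcomp Require Import interval_inference ring lra zify.

(** Insertability is obstructed one vertex at a time. If a vertex p of the
    hull of S and a point x satisfy p - x = sum of mu_s (s - p) with s in S
    and mu_s >= 0, then p is no longer a vertex once x is added, because no
    linear functional can be larger at p than at x and at every other point
    of S. By duality this cone condition is [in_shadow]: every functional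
    that is maximal over S at p is at least as large at x.

    A plain product of an n-gon Q with the cube cannot work for n > 4: Q
    then contains a lattice point that is not a vertex, and this point,
    paired with any lattice point outside the cube, is insertable. So the
    slices are made to vary. Let V false be the corners of an n-gon A, and
    V true those of the polygon A' obtained by exchanging the two
    coordinates of the plane; the polytope is the hull of the slices
    A x {w} for vertices w of the cube with an even number of ones and A' x {w}
    for the others, so that adjacent vertices of the cube carry different
    polygons. Each listed point is a vertex. For a lattice point (x, t),
    let w be the vertex of the cube nearest to t, and let u be the sum of
    the distances |t_k - w_k|. The vector w - t is a nonnegative
    combination of edges of the cube at w, with weights of sum u, and these
    edges lead to slices of the other type. The shadow condition at (v, w)
    becomes planar ([prism_shadow]): the point x + u v', with v' a corner
    of the other polygon, should lie in the shadow of (1 + u) v for the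
    polygon dilated by 1 + u. [twisted_prism] reduces the theorem to this
    planar property, except that for u = 0 the point x may also lie in the
    slice itself.

    For n = 2N + 2 the polygon A has corners (a, 6 a (a - N)) and
    (a, 1 + a (N - a)) for 0 <= a <= N: two corners at each abscissa. For N >= 2 it
    is much taller than wide. For u = 0, a lattice point above or below A
    is in the shadow of the corner nearest to it on its vertical line
    ([shadow_vertical]). A point far enough to the left or to the right is
    in the shadow of one of the two corners on that side ([shadow_left],
    [shadow_right]), and lattice points outside the strip 0 <= X <= N are
    far enough when u = 0. For u >= 1, A' is so wide that v' can be chosen
    to push x + u v' far enough to one side. The remaining case N = 1 is
    the unit square, where v is the corner nearest to x and v' = v.

    For n = 2N + 1 with N >= 3, the upper corner (0, 1) is raised to
    (0, 5). The upper point of abscissa 1 is then replaced by (1, N + 1), the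
    midpoint of the neighbouring upper corners, and is no longer a corner.
    The slopes are such that the lattice points above this midpoint are in
    the shadow of the upper corner of abscissa 2; this uses the upper
    corner of abscissa 3, whence N >= 3, which excludes pentagons. *)

Set Implicit Arguments.
Unset Strict Implicit.
Unset Printing Implicit Defensive.

Import Order.TTheory GRing.Theory Num.Theory.

Local Open Scope classical_set_scope.
Local Open Scope card_scope.
Local Open Scope ring_scope.

(** * Convex hulls and vertices *)

Lemma convex_setP (R : realType) (d : nat) (A : set 'rV[R]_d) :
  @convex_set R 'rV[R]_d A <->
  forall x y l, 0 <= l <= 1 -> A x -> A y -> A (l *: x + (1 - l) *: y).
Proof.
split=> [cA x y l /andP[l0 l1] Ax Ay | cA x y l /set_mem Ax /set_mem Ay].
  by have /set_mem := cA x y (Itv01 l0 l1) (mem_set Ax) (mem_set Ay).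
by apply/mem_set/(cA x y l%:num); rewrite // ge0 le1.
Qed.

Lemma convex_hull_sub (R : realType) (d : nat) (S : set 'rV[R]_d) :
  S `<=` convex_hull S.
Proof. exact: sub_gen_smallest. Qed.

Lemma convex_hull_min (R : realType) (d : nat) (S A : set 'rV[R]_d) :
  @convex_set R 'rV[R]_d A -> S `<=` A -> convex_hull S `<=` A.
Proof. exact: smallest_sub. Qed.

Lemma convex_hull_conv (R : realType) (d : nat) (S : set 'rV[R]_d) x y l :
  0 <= l <= 1 -> convex_hull S x -> convex_hull S y ->
  convex_hull S (l *: x + (1 - l) *: y).
Proof.
move=> l01 Sx Sy A CSA; have [/convex_setP cA _] := CSA.
exact: cA l01 (Sx A CSA) (Sy A CSA).
Qed.

Lemma convex_hull_image (R : realType) (d e : nat) (f : 'rV[R]_d -> 'rV[R]_e)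
    (S : set 'rV[R]_d) (T : set 'rV[R]_e) :
  (forall x y l, f (l *: x + (1 - l) *: y) = l *: f x + (1 - l) *: f y) ->
  (forall x, S x -> convex_hull T (f x)) ->
  forall x, convex_hull S x -> convex_hull T (f x).
Proof.
move=> f_aff fS; apply: (@convex_hull_min _ _ S [set x | convex_hull T (f x)]).
  apply/convex_setP => x y l l01 /= Tx Ty.
  by rewrite f_aff; apply: convex_hull_conv.
exact: fS.
Qed.

Lemma dotrvDr (R : realType) (d : nat) (c x y : 'rV[R]_d) :
  dotrv c (x + y) = dotrv c x + dotrv c y.
Proof.
by rewrite /dotrv -big_split; apply: eq_bigr => j _; rewrite !mxE mulrDr.
Qed.

Lemma dotrvZr (R : realType) (d : nat) (c x : 'rV[R]_d) l :
  dotrv c (l *: x) = l * dotrv c x.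
Proof.
by rewrite /dotrv mulr_sumr; apply: eq_bigr => j _; rewrite !mxE mulrCA.
Qed.

Lemma dotrv_row_mx (R : realType) (m n : nat) (c x : 'rV[R]_m)
    (e y : 'rV[R]_n) :
  dotrv (row_mx c e) (row_mx x y) = dotrv c x + dotrv e y.
Proof.
rewrite /dotrv big_split_ord /=; congr (_ + _); apply: eq_bigr => j _.
  by rewrite !row_mxEl.
by rewrite !row_mxEr.
Qed.

(** If v were not in S, the open half-space of points below v for an exposing
    functional would be a convex set containing S, hence would contain v. *)
Lemma vertices_convex_hull_sub (R : realType) (d : nat) (S : set 'rV[R]_d) :
  vertices (convex_hull S) `<=` S.
Proof.
move=> v [hv [c cv]]; apply: contrapT => nSv.
suff /(_ v hv) : convex_hull S `<=` [set y | dotrv c y < dotrv c v].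
  by rewrite /= ltxx.
apply: convex_hull_min => [|s Ss]; last first.
  by apply: cv; [apply: convex_hull_sub | move=> sv; apply: nSv; rewrite -sv].
apply/convex_setP => x y l l01 /=; rewrite dotrvDr !dotrvZr => xv yv.
have [->|l1] := eqVneq l 1; first by lra.
have : 0 < (1 - l) * (dotrv c v - dotrv c y) by apply: mulr_gt0; lra.
have : 0 <= l * (dotrv c v - dotrv c x) by apply: mulr_ge0; lra.
lra.
Qed.

(** The points equal to s or strictly below s form a convex set, so that
    exposing s among the generators suffices. *)
Lemma exposed_vertex (R : realType) (d : nat) (S : set 'rV[R]_d)
    (s c : 'rV[R]_d) :
  S s -> (forall y, S y -> y <> s -> dotrv c y < dotrv c s) ->
  vertices (convex_hull S) s.
Proof.
move=> Ss cs; split; first exact: convex_hull_sub.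
exists c => y hy ys.
suff /(_ y hy) [//|] : convex_hull S `<=`
  [set y | y = s \/ dotrv c y < dotrv c s] by [].
apply: convex_hull_min => [|z Sz]; last first.
  by have [->|/eqP zs] := eqVneq z s; [left | right; apply: cs].
apply/convex_setP => {hy ys}x {}y l l01 /=.
have [->|l0] := eqVneq l 0; first by rewrite scale0r add0r subr0 scale1r.
have [->|l1] := eqVneq l 1; first by rewrite subrr scale0r addr0 scale1r.
have ll0 : 0 < l by lra.
have ll1 : 0 < 1 - l by lra.
case=> [->|xs] [->|ys].
- by left; rewrite -scalerDl addrC subrK scale1r.
- right; rewrite dotrvDr !dotrvZr.
  have : 0 < (1 - l) * (dotrv c s - dotrv c y) by apply: mulr_gt0; lra.
  lra.
- right; rewrite dotrvDr !dotrvZr.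
  have : 0 < l * (dotrv c s - dotrv c x) by apply: mulr_gt0; lra.
  lra.
- right; rewrite dotrvDr !dotrvZr.
  have : 0 < (1 - l) * (dotrv c s - dotrv c y) by apply: mulr_gt0; lra.
  have : 0 < l * (dotrv c s - dotrv c x) by apply: mulr_gt0; lra.
  lra.
Qed.

(** * Shadows and insertability *)

(** By Farkas' lemma, this says for finite S that p - x belongs to the cone
    generated by the vectors s - p.  The dual form spares the coefficients. *)
Definition in_shadow (R : realType) (d : nat) (S : set 'rV[R]_d)
    (p x : 'rV[R]_d) : Prop :=
  forall c, (forall s, S s -> dotrv c s <= dotrv c p) -> dotrv c p <= dotrv c x.

(** A functional that exposes p after the insertion of x is maximal over S at p
    and strictly smaller at x, against the definition of a shadow. *)
Lemma shadow_not_insertable (R : realType) (d : nat) (S : set 'rV[R]_d)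
    (p x : 'rV[R]_d) :
  vertices (convex_hull S) p -> in_shadow S p x ->
  ~ insertable (convex_hull S) x.
Proof.
move=> vp shx [nPx eqv].
have : vertices (convex_hull (convex_hull S `|` [set x])) p.
  by rewrite eqv; left.
case=> _ [c cp].
have xp : x <> p by move=> xp; apply: nPx; rewrite xp; case: vp.
have := cp x (convex_hull_sub (or_intror erefl)) xp.
rewrite ltNge shx // => s Ss.
have [->//|/eqP sp] := eqVneq s p.
by apply/ltW/cp => //; apply: convex_hull_sub; left; apply: convex_hull_sub.
Qed.

(** * Size and dimension *)

Lemma card_range_inj (R : realType) (d : nat) (T : finType)
    (f : T -> 'rV[R]_d) :
  injective f -> range f #= `I_#|T|.
Proof.
move=> f_inj.
have -> : `I_#|T| = range (fun t : T => enum_rank t : nat).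
  apply/seteqP; split=> [k /= kT|_ [t _ <-]]; last exact: ltn_ord.
  by exists (enum_val (Ordinal kT)); rewrite // enum_valK.
apply: (card_eq_trans (inj_card_eq _)); first by move=> ? ? _ _ /f_inj.
apply: card_esym; apply: inj_card_eq => s t _ _ st.
exact/enum_rank_inj/val_inj.
Qed.

(** The origin and one point on each coordinate axis give a diagonal difference
    matrix. *)
Lemma affine_dim_full (R : realType) (d : nat) (P : set 'rV[R]_d)
    (g : 'I_d -> R) :
  P 0 -> (forall j, g j != 0) -> (forall j, P (g j *: delta_mx 0 j)) ->
  affine_dim P d.
Proof.
move=> P0 g0 Pg; split; last first.
  by move=> l p _ /eqP <-; apply: rank_leq_col.
pose p (i : 'I_d.+1) : 'rV[R]_d :=
  if unlift ord0 i is Some j then g j *: delta_mx 0 j else 0.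
exists p => [i|]; first by rewrite /p; case: unliftP.
rewrite /affinely_independent.
have -> : \matrix_(i < d) (p (lift ord0 i) - p ord0) = diag_mx (\row_j g j).
  apply/matrixP => i j.
  rewrite [LHS]mxE /p liftK unlift_none subr0 !mxE eqxx /=.
  by rewrite eq_sym; case: eqP => [->|]; rewrite ?mulr1 ?mulr0.
rewrite row_free_unit unitmxE det_diag unitfE.
by apply/prodf_neq0 => j _; rewrite mxE.
Qed.

(** * Twisted prisms over the cube *)

(** Vertices of the cube are encoded by their sets of ones, so that parity is
    that of a cardinal. *)
Definition cube_vertex (R : realType) (m : nat) (w : {set 'I_m}) : 'rV[R]_m :=
  \row_k (k \in w)%:R.

Definition flip (m : nat) (w : {set 'I_m}) (k : 'I_m) : {set 'I_m} :=
  if k \in w then w :\ k else k |: w.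

Lemma odd_card_flip (m : nat) (w : {set 'I_m}) k :
  odd #|flip w k| = ~~ odd #|w|.
Proof.
rewrite /flip; case: ifPn => kw; last by rewrite cardsU1 kw.
by rewrite (cardsD1 k w) kw /= negbK.
Qed.

Lemma cube_vertex_flip (R : realType) (m : nat) (w : {set 'I_m}) k :
  cube_vertex R (flip w k) =
  cube_vertex R w + (1 - 2 * (k \in w)%:R) *: delta_mx 0 k.
Proof.
apply/rowP => j; rewrite !mxE eqxx /= /flip.
have [->|jk] := eqVneq j k; last first.
  by rewrite mulr0 addr0; case: ifP => _; rewrite !inE ?(negPf jk).
by case: ifPn => kw; rewrite !inE eqxx /= ?kw ?(negPf kw); ring.
Qed.

Lemma cube_vertex_inj (R : realType) (m : nat) : injective (@cube_vertex R m).
Proof.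
move=> v w vw; apply/setP => k.
have := congr1 (fun z : 'rV[R]_m => z 0 k) vw; rewrite !mxE => /eqP.
by rewrite eqr_nat; case: (k \in v); case: (k \in w).
Qed.

Definition prism_vertex (R : realType) (m : nat) (T : finType)
    (V : bool -> T -> 'rV[R]_2) (iw : T * {set 'I_m}) : 'rV[R]_(2 + m) :=
  row_mx (V (odd #|iw.2|) iw.1) (cube_vertex R iw.2).

(** The sign vector of w exposes w in the cube with a margin of at least 1; the
    margin can be scaled to dominate whatever happens inside the slices. *)
Lemma dotrv_cube_sign (R : realType) (m : nat) (v w : {set 'I_m}) :
  v != w ->
  dotrv (\row_k (2 * (k \in w)%:R - 1)) (cube_vertex R v) + 1 <=
  dotrv (\row_k (2 * (k \in w)%:R - 1)) (cube_vertex R w).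
Proof.
move=> vw.
have [k kvw] : exists k, (k \in v) != (k \in w).
  apply/existsP; apply: contraT; rewrite negb_exists => /forallP h.
  by case/eqP: vw; apply/setP => k; apply/eqP; have := h k; rewrite negbK.
rewrite /dotrv (bigD1 k) //= [leRHS](bigD1 k) //= addrAC lerD //.
  by rewrite !mxE; move: kvw; case: (k \in v); case: (k \in w) => //= _; lra.
apply: ler_sum => j _; rewrite !mxE.
by case: (j \in v); case: (j \in w) => /=; lra.
Qed.

Lemma prism_vertex_exposed (R : realType) (m : nat) (T : finType)
    (V : bool -> T -> 'rV[R]_2)
    (Vex : forall b i, exists c, forall j, j != i ->
       dotrv c (V b j) < dotrv c (V b i)) (iw : T * {set 'I_m}) :
  exists c, forall jv, jv != iw ->
    dotrv c (prism_vertex V jv) < dotrv c (prism_vertex V iw).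
Proof.
case: iw => i w; have [c ci] := Vex (odd #|w|) i.
pose B := \sum_(p : bool * T) `|dotrv c (V p.1 p.2)|.
have B_ge b j : `|dotrv c (V b j)| <= B.
  by rewrite /B (bigD1 (b, j)) //= lerDl sumr_ge0.
(* A functional exposing the corner in its slice, plus a multiple of the sign
   vector so large that it wins against any change of slice. *)
exists (row_mx c ((2 * B + 1) *: (\row_k (2 * (k \in w)%:R - 1)))).
move=> [j v]; rewrite /prism_vertex !dotrv_row_mx /=.
have dotrvZl (e x : 'rV[R]_m) l : dotrv (l *: e) x = l * dotrv e x.
  by rewrite /dotrv mulr_sumr; apply: eq_bigr => k _; rewrite !mxE mulrA.
rewrite !dotrvZl; have [->|vw] := eqVneq v w.
  by rewrite xpair_eqE eqxx andbT => /ci; rewrite ltrD2r.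
move=> _; have := dotrv_cube_sign R vw.
have := B_ge (odd #|v|) j; have := B_ge (odd #|w|) i.
rewrite !ler_norml => /andP[h1 h2] /andP[h3 h4] h5.
set e := \row_k _ in h5 *.
have : 0 <= (2 * B + 1) *
    (dotrv e (cube_vertex R w) - dotrv e (cube_vertex R v) - 1).
  by apply: mulr_ge0; lra.
lra.
Qed.

(** A functional maximal at the vertex over w is constrained by its values on
    the slice over w and on the slices over the neighbours of w.  Adding the
    latter constraints with weights |t_k - w_k| moves w to t, at the price of
    u copies of the difference between a corner of the other polygon and the
    given corner. *)
Lemma prism_shadow (R : realType) (m : nat) (T : finType)
    (V : bool -> T -> 'rV[R]_2) (x : 'rV[R]_2) (t : 'rV[R]_m)
    (w : {set 'I_m}) (i j : T) (b := odd #|w|)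
    (u := \sum_k `|t 0 k - (k \in w)%:R|)
    (wt : forall k, if k \in w then 1 <= t 0 k else t 0 k <= 0) :
  (forall c, (forall k, dotrv c (V b k) <= dotrv c (V b i)) ->
    (1 + u) * dotrv c (V b i) <= dotrv c x + u * dotrv c (V (~~ b) j)) ->
  in_shadow (range (prism_vertex V)) (prism_vertex V (i, w)) (row_mx x t).
Proof.
move=> sh c0; rewrite -[c0]hsubmxK.
move: (lsubmx c0) (rsubmx c0) => c e {c0} cS.
have ci k : dotrv c (V b k) <= dotrv c (V b i).
  have := cS _ (ex_intro2 _ _ (k, w) I erefl).
  by rewrite /prism_vertex !dotrv_row_mx lerD2r.
have := sh c ci; rewrite {sh}/prism_vertex !dotrv_row_mx /= -/b => sh.
pose D := dotrv c (V (~~ b) j) - dotrv c (V b i).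
have flipk k : D + (1 - 2 * (k \in w)%:R) * e 0 k <= 0.
  have := cS _ (ex_intro2 _ _ (j, flip w k) I erefl).
  rewrite /prism_vertex !dotrv_row_mx /= odd_card_flip -/b cube_vertex_flip.
  rewrite dotrvDr dotrvZr.
  have -> : dotrv e (delta_mx 0 k) = e 0 k.
    rewrite /dotrv (bigD1 k) //= big1 ?addr0 ?mxE ?eqxx ?mulr1 // => l lk.
    by rewrite mxE (negPf lk) andbF mulr0.
  by rewrite /D; lra.
have : u * D + dotrv e (cube_vertex R w) <= dotrv e t.
  rewrite /u mulr_suml /dotrv -big_split; apply: ler_sum => k _ /=.
  rewrite mxE; have := flipk k; have := wt k.
  case: (k \in w) => /= tk dk.
    by rewrite ger0_norm; nra.
  by rewrite ler0_norm; nra.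
by rewrite /D; lra.
Qed.

(** The slice over w and the slices over its neighbours are of opposite types,
    whence the pairing of V b with V (~~ b) in [Vsh].  In its first alternative
    the point already belongs to the slice, hence to the polytope. *)
Lemma twisted_prism (R : realType) (m : nat) (T : finType)
    (V : bool -> T -> 'rV[R]_2)
    (Vlat : forall b i, lattice_point (V b i))
    (Vex : forall b i, exists c, forall j, j != i ->
       dotrv c (V b j) < dotrv c (V b i))
    (Vsh : forall b x (u : R), lattice_point x -> u = 0 \/ 1 <= u ->
       u = 0 /\ convex_hull (range (V b)) x \/
       exists i j, forall c, (forall k, dotrv c (V b k) <= dotrv c (V b i)) ->
         (1 + u) * dotrv c (V b i) <= dotrv c x + u * dotrv c (V (~~ b) j))
    (V0 : forall b, exists i, V b i = 0)
    (Vaxis : forall j : 'I_2, exists i g,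
       g != 0 /\ V false i = g *: delta_mx 0 j) :
  exists P : set 'rV[R]_(2 + m),
    [/\ lattice_polytope P,
        affine_dim P (2 + m),
        vertices P #= `I_(#|T| * 2 ^ m)%N &
        forall x : 'rV[R]_(2 + m), lattice_point x -> ~ insertable P x].
Proof.
pose f := @prism_vertex R m T V; pose S := range f.
have f_inj : injective f.
  move=> iw jv ij; apply/eqP; apply: contraT => ne.
  have [c /(_ iw ne)] := prism_vertex_exposed Vex jv.
  by rewrite -/f ij ltxx.
have vS : vertices (convex_hull S) = S.
  apply/seteqP; split; first exact: vertices_convex_hull_sub.
  move=> _ [iw _ <-]; have [c ciw] := prism_vertex_exposed Vex iw.
  apply: (@exposed_vertex _ _ _ _ c); first by exists iw.
  move=> _ [jv _ <-] ne; apply: ciw.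
  by apply/eqP => e; apply: ne; rewrite e.
have cardS : S #= `I_(#|T| * 2 ^ m).
  have := card_range_inj f_inj.
  suff -> : #|{: T * {set 'I_m}}| = (#|T| * 2 ^ m)%N by [].
  rewrite card_prod -[X in (_ * X)%N]cardsT -powersetT card_powerset.
  by rewrite cardsT card_ord.
exists (convex_hull S); split.
- split; first by exists S => //; apply/finite_setP; exists (#|T| * 2 ^ m)%N.
  rewrite vS => _ [[i w] _ <-] j; rewrite /f /prism_vertex mxE.
  by case: splitP => k _; rewrite ?Vlat // mxE natr_int.
- have vertexS i w : convex_hull S (f (i, w)).
    by apply: convex_hull_sub; exists (i, w).
  have cube0 : cube_vertex R (@finset.set0 'I_m) = 0.
    by apply/rowP => k; rewrite !mxE inE.
  have axis (j : 'I_(2 + m)) :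
      exists g, g != 0 /\ convex_hull S (g *: delta_mx 0 j).
    rewrite -(splitK j); case: (split j) => k /=.
      have [i [g [g0 Vi]]] := Vaxis k; exists g; split => //.
      rewrite delta_mx_lshift scale_row_mx scaler0 -Vi.
      have := vertexS i finset.set0.
      by rewrite /f /prism_vertex /= cards0 cube0.
    have [i Vi] := V0 true; exists 1; split; first exact: oner_neq0.
    rewrite scale1r delta_mx_rshift -Vi.
    have := vertexS i [set k]%SET; rewrite /f /prism_vertex /= cards1.
    congr (convex_hull _ (row_mx _ _)).
    by apply/rowP => l; rewrite !mxE inE eqxx.
  have [g gP] := choice axis.
  apply: (@affine_dim_full _ _ _ g) => [|j|j];
    [|exact: (gP j).1|exact: (gP j).2].
  have [i Vi] := V0 false; have := vertexS i finset.set0.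
  by rewrite /f /prism_vertex /= cards0 cube0 Vi row_mx0.
- by rewrite vS.
move=> z; rewrite -[z]hsubmxK; move: (lsubmx z) (rsubmx z) => x t {z} zlat.
have xlat : lattice_point x.
  by move=> j; have := zlat (lshift m j); rewrite row_mxEl.
have tlat k : t 0 k \is a Num.int.
  by have := zlat (rshift 2 k); rewrite row_mxEr.
pose w : {set 'I_m} := [set k | 1 <= t 0 k]%SET.
have wt k : if k \in w then 1 <= t 0 k else t 0 k <= 0.
  rewrite inE; case: ifPn => //; rewrite -ltNge.
  by have /intrP[n ->] := tlat k; rewrite -[1]/(1%:~R) ltr_int lerz0; lia.
pose u := \sum_k `|t 0 k - (k \in w)%:R|.
have [ut|ut] : (u = 0 /\ t = cube_vertex R w) \/ 1 <= u.
  have [t_w|/eqP t_w] := eqVneq t (cube_vertex R w); [left|right].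
    by split=> //; apply: big1 => k _; rewrite t_w mxE subrr normr0.
  have [k tk] : exists k, t 0 k != (k \in w)%:R.
    apply/existsP; apply: contraT; rewrite negb_exists => /forallP h.
    case: t_w; apply/rowP => k; rewrite mxE; apply/eqP.
    by have := h k; rewrite negbK.
  rewrite /u (bigD1 k) //=.
  suff : 1 <= `|t 0 k - (k \in w)%:R|.
    by move/le_trans; apply; rewrite lerDl sumr_ge0.
  by rewrite norm_intr_ge1 ?subr_eq0 // rpredB ?natr_int.
- case: ut => u0 tw.
  have [[_ hx]|[i [j sh]]] := Vsh (odd #|w|) x u xlat (or_introl u0).
    case; apply: contra_notP => _; rewrite tw.
    move: x hx {xlat zlat}; apply: convex_hull_image.
      move=> a b l; rewrite !scale_row_mx add_row_mx -scalerDl.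
      by rewrite subrKC scale1r.
    by move=> _ [i _ <-]; apply: convex_hull_sub; exists (i, w).
  apply: shadow_not_insertable (prism_shadow wt sh).
  by rewrite vS; exists (i, w).
have [[u0 _]|[i [j sh]]] := Vsh (odd #|w|) x u xlat (or_intror ut).
  by move: ut; rewrite u0 ler10.
apply: shadow_not_insertable (prism_shadow wt sh).
by rewrite vS; exists (i, w).
Qed.

(** * The polygons *)

(** The lower chain follows the parabola 6 a (a - N) and the upper chain
    1 + a (N - a); the flag [o] selects the odd variant, in which the upper
    left corner is raised by 4. *)
Definition corner_height (R : realType) (N : nat) (o top : bool) (a : nat) :
    R :=
  if top then 1 + a%:R * (N%:R - a%:R) + (if o && (a == 0)%N then 4 else 0)
  else 6 * a%:R * (a%:R - N%:R).

(** In the odd variant the upper boundary has at abscissa 1 the midpoint of its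
    corners (0, 5) and (2, 2N - 3). *)
Definition is_corner (N : nat) (o top : bool) (a : nat) : bool :=
  (a <= N)%N && ~~ [&& o, top & a == 1%N].

(** The point (x, y) is in the shadow of s v with respect to the polygon dilated
    by s, for some corner v. *)
Definition scaled_shadow (R : realType) (N : nat) (o : bool) (s x y : R) :
    Prop :=
  exists top a, is_corner N o top a /\
    forall c0 c1 : R,
      (forall top' a', is_corner N o top' a' ->
         c0 * a'%:R + c1 * corner_height R N o top' a' <=
         c0 * a%:R + c1 * corner_height R N o top a) ->
      s * (c0 * a%:R + c1 * corner_height R N o top a) <= c0 * x + c1 * y.

Definition upper_height (R : realType) (N : nat) (o : bool) (a : nat) : R :=
  if o && (a == 1)%N then N%:R + 1 else corner_height R N o true a.

(** A functional bounded on the corners is bounded on the upper boundary: the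
    point of abscissa 1 in the odd variant is the midpoint of the corners of
    abscissas 0 and 2. *)
Lemma upper_height_le (R : realType) (N : nat) (o : bool) (c0 c1 M : R) a :
  (o -> (2 < N)%N) -> (a <= N)%N ->
  (forall top a, is_corner N o top a ->
     c0 * a%:R + c1 * corner_height R N o top a <= M) ->
  c0 * a%:R + c1 * upper_height R N o a <= M.
Proof.
move=> oN aN cM; rewrite /upper_height.
case: ifPn => [/andP[o1 /eqP a1]|oa]; last first.
  by apply: cM; rewrite /is_corner aN.
have N3 := oN o1.
have := cM true 0%N; have := cM true 2%N.
rewrite /corner_height /is_corner o1 a1 /= (ltnW N3) => /(_ isT) h2 /(_ isT) h0.
by lra.
Qed.

(** The normals of the two parabolas expose the corners.  Only at abscissa 2 in
    the odd variant does the normal (4 - N, 1) of the upper parabola tie with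
    the raised corner (0, 5); the normal (9/2 - N, 1) lies strictly between
    those of the two edges meeting there. *)
Lemma corner_exposed (R : realType) (N : nat) (o top : bool) (a : nat) :
  (o -> (2 < N)%N) -> is_corner N o top a ->
  exists c0 c1 : R, forall top' a', is_corner N o top' a' ->
    (top', a') != (top, a) ->
    c0 * a'%:R + c1 * corner_height R N o top' a' <
    c0 * a%:R + c1 * corner_height R N o top a.
Proof.
move=> oN; rewrite /is_corner => /andP[aN oa].
have dist i : i != a -> 1 <= (i%:R - a%:R : R) ^+ 2.
  move=> ia; rewrite -real_normK ?num_real // exprn_ege1 //.
  by rewrite norm_intr_ge1 ?rpredB ?natr_int // subr_eq0 eqr_nat.
have inner i : (i <= N)%N -> 0 <= i%:R * (N%:R - i%:R) :> R.
  by move=> iN; rewrite mulr_ge0 // subr_ge0 ler_nat.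
have bump i : 0 <= (if o && (i == 0)%N then 4 else 0) :> R by case: ifP.
case: top oa => /= oa; last first.
  exists (6 * (2 * a%:R - N%:R)), (-1) => top i /andP[iN _].
  have := inner i iN; have := bump i; have := sqr_ge0 (i%:R - a%:R : R).
  rewrite /corner_height; case: top => /=.
    by move: (if _ then _ else _) => e + + + _; lra.
  by move=> _ _ _; rewrite xpair_eqE /= => /dist; lra.
have [/andP[o1 /eqP a2]|gen] := boolP (o && (a == 2)%N); last first.
  exists (2 * a%:R - N%:R), 1 => top i /andP[iN oi].
  have := inner i iN; have := sqr_ge0 (i%:R - a%:R : R).
  rewrite /corner_height; have := bump a.
  move: (if o && (a == 0%N) then _ else _) => e e0.
  case: top oi => /= oi; last by move=> + + _; lra.
  move=> _ _; rewrite xpair_eqE /= => ia; have := dist i ia.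
  case: ifP; last by lra.
  move=> /andP[o1 /eqP i0] _; have : 3 <= a%:R :> R.
    rewrite (ler_nat _ 3); move: gen oa ia; rewrite o1 i0 /=.
    by case: (a) => [|[|[|]]].
  by rewrite i0; nra.
have N3 := oN o1; have N3R : 3 <= N%:R :> R by rewrite (ler_nat _ 3).
have low i : (i <= N)%N -> i = 0%N \/ 1 <= i%:R :> R.
  by case: i => [|i] _; [left | right; rewrite ler1n].
have high i : (i <= N)%N -> i = N \/ i%:R + 1 <= N%:R :> R.
  rewrite leq_eqVlt => /orP[/eqP|iN]; [by left | right].
  by rewrite natr1 ler_nat.
exists (9 - 2 * N%:R), 2 => top i /andP[iN oi].
move: oi; rewrite a2 /corner_height o1; case: top => /= oi.
  case: i iN oi => [|[|[|i]]] //= iN _; first by move=> _; lra.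
  move=> _; rewrite -(natr1 i.+2) -(natr1 i.+1) -(natr1 i).
  by have := ler0n R i; nra.
move=> _; have := high i iN; have [->|i1] := low i iN.
  by move=> _; lra.
case=> [->|iN1]; first by nra.
have : 1 <= N%:R - i%:R :> R by lra.
have : 0 <= (i%:R - 1) * (N%:R - i%:R - 1) :> R by apply: mulr_ge0; lra.
by nra.
Qed.

(** Beyond the right edge, the points in neither of the shadows of its two ends
    form the triangle between this edge and the prolongations of the two
    chains.  The chains are so steep that these prolongations have crossed when
    the distance k to the edge reaches its length s. *)
Lemma shadow_right (R : realType) (N : nat) (o : bool) (s x y : R) :
  (1 < N)%N -> (o -> (2 < N)%N) -> 1 <= s -> s * (N%:R + 1) <= x ->
  scaled_shadow N o s x y.
Proof.
move=> N2 oN s1 xN.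
have N2R : 2 <= N%:R :> R by rewrite (ler_nat _ 2).
have N0 : (N == 0)%N = false by case: (N) N2.
have N1 : (N == 1)%N = false by case: (N) N2 => [|[]].
have NE : N.-1%:R = N%:R - 1 :> R by rewrite -subn1 natrB // ltnW.
pose k := x - s * N%:R; have k_ge : s <= k by rewrite /k; lra.
have [yk|yk] := lerP (s - k * (N%:R - 1)) y.
  exists true, N; split; first by rewrite /is_corner leqnn N1 !andbF.
  move=> c0 c1 cM; have := cM false N; have := cM true N.-1.
  rewrite /is_corner leqnn leq_pred /= !andbF => hN1 /(_ isT).
  have /hN1 : ~~ (o && (N.-1 == 1%N)).
    by apply/negP => /andP[/oN]; case: (N) => [|[|[]]].
  have N10 : (N.-1 == 0)%N = false by case: (N) N2 => [|[]].
  rewrite /corner_height N0 N10 !andbF NE => h1 h2.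
  have c1_ge0 : 0 <= c1 by lra.
  have : 0 <= k * (c0 - (N%:R - 1) * c1) by apply: mulr_ge0; lra.
  have : 0 <= c1 * (y - (s - k * (N%:R - 1))) by apply: mulr_ge0; lra.
  by rewrite /k; lra.
exists false, N; split; first by rewrite /is_corner leqnn !andbF.
move=> c0 c1 cM; have := cM true N; have := cM false N.-1.
rewrite /is_corner leqnn leq_pred N1 /= !andbF => /(_ isT) h1 /(_ isT).
move: h1; rewrite /corner_height N0 !andbF NE => h1 h2.
have c1_le0 : 0 <= - c1 by lra.
have yk' : y <= 6 * (N%:R - 1) * k by nra.
have : 0 <= k * (c0 + 6 * (N%:R - 1) * c1) by apply: mulr_ge0; lra.
have : 0 <= - c1 * (6 * (N%:R - 1) * k - y) by apply: mulr_ge0; lra.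
by rewrite /k; lra.
Qed.

(** The triangle to avoid is now based on an edge of length s h, where h = 5 in
    the odd variant, and r is the slope of the first upper edge.  The steepness
    of the lower chain still makes the prolongations cross within distance s. *)
Lemma shadow_left (R : realType) (N : nat) (o : bool) (s x y : R) :
  (1 < N)%N -> (o -> (2 < N)%N) -> 1 <= s -> x <= - s ->
  scaled_shadow N o s x y.
Proof.
move=> N2 oN s1 xs.
have N2R : 2 <= N%:R :> R by rewrite (ler_nat _ 2).
pose h : R := if o then 5 else 1.
pose r : R := if o then N%:R - 4 else N%:R - 1.
have h0 : corner_height R N o true 0 = h.
  by rewrite /corner_height /h eqxx andbT; case: (o); ring.
have hr : h <= r + 6 * (N%:R - 1).
  rewrite /h /r; case: (o) oN => [/(_ isT) N3|_]; last by lra.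
  have N3R : 3 <= N%:R :> R by rewrite (ler_nat _ 3).
  by lra.
have h_gt0 : 0 < h by rewrite /h; case: (o).
have upper c0 c1 (cM : forall top' a', is_corner N o top' a' ->
    c0 * a'%:R + c1 * corner_height R N o top' a' <= c0 * 0%:R + c1 * h) :
    c0 + r * c1 <= 0.
  move: cM; rewrite /h /r; case: (o) oN => [/(_ isT) N3|_] cM.
    have := cM true 2%N; rewrite /is_corner (ltnW N3) /= => /(_ isT).
    by rewrite /corner_height /=; lra.
  have := cM true 1%N; rewrite /is_corner (ltnW N2) /= => /(_ isT).
  by rewrite /corner_height /=; lra.
have [yk|yk] := lerP (s * h + x * r) y.
  exists true, 0%N; split; first by rewrite /is_corner !andbF.
  move=> c0 c1; rewrite h0 => cM; have := upper _ _ cM.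
  have := cM false 0%N; rewrite /is_corner !andbF /= => /(_ isT).
  rewrite /corner_height => h1 h2.
  have c1_ge0 : 0 <= c1 by nra.
  have : 0 <= - x * (- (c0 + r * c1)) by apply: mulr_ge0; lra.
  have : 0 <= c1 * (y - (s * h + x * r)) by apply: mulr_ge0; lra.
  by lra.
exists false, 0%N; split; first by rewrite /is_corner !andbF.
move=> c0 c1 cM; have := cM true 0%N; have := cM false 1%N.
rewrite h0 /is_corner (ltnW N2) /= !andbF => /(_ isT) h1 /(_ isT).
move: h1; rewrite /corner_height => h1 h2.
have c1_le0 : 0 <= - c1 by nra.
have : s * h + x * r <= 6 * (N%:R - 1) * - x.
  have : 0 <= (- x - s) * h by apply: mulr_ge0; lra.
  have : 0 <= - x * (r + 6 * (N%:R - 1) - h) by apply: mulr_ge0; lra.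
  by lra.
move=> yk'.
have : 0 <= - x * (6 * (N%:R - 1) * c1 - c0) by apply: mulr_ge0; lra.
have : 0 <= - c1 * (6 * (N%:R - 1) * - x - y) by apply: mulr_ge0; lra.
by lra.
Qed.

(** Outside A, the point is vertically above or below a corner, whose opposite
    cone contains the outward vertical ray.  The exception is the point above
    the midpoint (1, N + 1): being integral it has ordinate at least N + 2,
    which is where the line through the upper corners of abscissas 3 and 2
    meets the line X = 1. *)
Lemma shadow_vertical (R : realType) (N : nat) (o : bool) (a : nat) (Y : int) :
  (o -> (2 < N)%N) -> (a <= N)%N ->
  corner_height R N o false a <= Y%:~R <= upper_height R N o a \/
  scaled_shadow N o 1 (a%:R : R) Y%:~R.
Proof.
move=> oN aN.
have gap : corner_height R N o false a < upper_height R N o a.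
  have : 0 <= a%:R * (N%:R - a%:R) :> R.
    by rewrite mulr_ge0 // subr_ge0 ler_nat.
  rewrite /upper_height /corner_height; case: ifP => [/andP[_ /eqP->]|_].
    by have := ler0n R N; lra.
  by case: ifP => _; lra.
have [lo|lo] := lerP (corner_height R N o false a) Y%:~R; last first.
  right; exists false, a; split; first by rewrite /is_corner aN !andbF.
  move=> c0 c1 cM; have := upper_height_le oN aN cM; rewrite mul1r => h1.
  have c1_le0 : 0 <= - c1 by nra.
  by rewrite lerD2l; nra.
have [hi|hi] := lerP Y%:~R (upper_height R N o a); [by left | right].
have [/andP[o1 /eqP a1]|oa] := boolP (o && (a == 1)%N); last first.
  exists true, a; split; first by rewrite /is_corner aN.
  move=> c0 c1 cM; have := cM false a; rewrite /is_corner aN !andbF /=.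
  move: gap hi; rewrite /upper_height (negPf oa) => gap hi /(_ isT) h1.
  have c1_ge0 : 0 <= c1.
    by move: h1; rewrite lerD2l -subr_ge0 -mulrBr pmulr_lge0 // subr_gt0.
  by rewrite mul1r lerD2l ler_wpM2l // ltW.
have N3 := oN o1; exists true, 2%N; split.
  by rewrite /is_corner (ltnW N3) andbF.
move=> c0 c1 cM; have := cM false 2%N; have := cM true 3%N.
rewrite /is_corner N3 (ltnW N3) !andbF /= => /(_ isT) h3 /(_ isT).
move: h3; rewrite /corner_height /= !andbF => h3 h2.
have N3R : 3 <= N%:R :> R by rewrite (ler_nat _ 3).
have c1_ge0 : 0 <= c1 by nra.
have Y2 : N%:R + 2 <= Y%:~R :> R.
  move: hi; rewrite /upper_height o1 a1 /= natr1 pmulrn ltr_int -natrD pmulrn.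
  by rewrite ler_int; lia.
have : 0 <= c1 * (Y%:~R - (N%:R + 2)) by apply: mulr_ge0; lra.
by rewrite a1; lra.
Qed.

(** The point that is translated by u times a corner of the exchanged polygon
    has coordinates (X + u height, Y + u abscissa). *)
Lemma planar_shadow (R : realType) (N : nat) (o : bool) (X Y : int) (u : R) :
  (0 < N)%N -> (o -> (2 < N)%N) -> u = 0 \/ 1 <= u ->
  (u = 0 /\ exists a : nat, [/\ (a <= N)%N, X = a &
     corner_height R N o false a <= Y%:~R <= upper_height R N o a]) \/
  exists top a, is_corner N o top a /\
    scaled_shadow N o (1 + u) (X%:~R + u * corner_height R N o top a)
      (Y%:~R + u * a%:R).
Proof.
move=> N_gt0 oN u01; have u_ge0 : 0 <= u by case: u01 => [->|]; lra.
have [N2|] := ltnP 1 N; last first.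
  rewrite leq_eqVlt ltnS leqNgt N_gt0 orbF => /eqP N1.
  have o0 : o = false by case: (o) oN => // /(_ isT); rewrite N1.
  move=> {oN u01}; rewrite {}o0 {}N1; right.
  have clamp (Z : int) :
      exists b : bool, if b then 1 <= Z%:~R :> R else Z%:~R <= 0 :> R.
    have [Z1|Z0] := lerP 1 Z; [exists true | exists false].
      by rewrite ler1z.
    by rewrite lerz0; lia.
  have [p Xp] := clamp X; have [q Yq] := clamp Y.
  have sq top (a : bool) : corner_height R 1 false top a = top%:R.
    by rewrite /corner_height /=; case: top; case: a => /=; ring.
  exists p, q; split; first by rewrite /is_corner; case: (q).
  exists q, p; split; first by rewrite /is_corner; case: (p).
  move=> c0 c1 cM; rewrite !sq.
  have := cM (~~ q) p; have := cM q (~~ p).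
  rewrite !sq /is_corner.
  case: p q Xp Yq {cM} => [] [] /= Xp Yq /(_ isT) h1 /(_ isT) h2; nra.
have N2R : 2 <= N%:R :> R by rewrite (ler_nat _ 2).
have NE : N.-1%:R = N%:R - 1 :> R by rewrite -subn1 natrB.
case: u01 => [u0|u1].
  subst u; case: (lerP 0 X) => [X0|X0]; last first.
    right; exists false, 0%N; split; first by rewrite /is_corner !andbF.
    apply: shadow_left => //; first by lra.
    have : X%:~R <= (-1)%:~R :> R by rewrite ler_int; lia.
    by lra.
  case: X X0 => // a _; have [aN|aN] := leqP a N; last first.
    right; exists false, 0%N; split; first by rewrite /is_corner !andbF.
    apply: shadow_right => //; first by lra.
    have : N%:R + 1 <= a%:R :> R by rewrite natr1 ler_nat.
    by rewrite -[a%:~R]/(a%:R : R); lra.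
  have [in_a|sh] := shadow_vertical R Y oN aN.
    by left; split=> //; exists a.
  right; exists false, 0%N; split; first by rewrite /is_corner !andbF.
  by rewrite !mul0r !addr0.
right.
(* The lower corner of abscissa 1 and the upper corner of abscissa N - 1 have
   heights differing by 7 N - 6, which suffices to leave the strip between the
   left and right regions. *)
have [Xl|Xr] := lerP (X%:~R - 6 * u * (N%:R - 1)) (- (1 + u)).
  exists false, 1%N; split; first by rewrite /is_corner N_gt0 !andbF.
  by apply: shadow_left => //; rewrite /corner_height; lra.
exists true, N.-1; split.
  rewrite /is_corner leq_pred /=.
  by apply/negP => /andP[/oN]; case: (N) => [|[|[]]].
apply: shadow_right => //; first by lra.
rewrite /corner_height.
have -> : (N.-1 == 0)%N = false by case: (N) N2 => [|[]].
by rewrite andbF NE; nra.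
Qed.

(** * Corners as plane vectors *)

Definition corner (N : nat) (o : bool) : finType :=
  {p : bool * 'I_N.+1 | is_corner N o p.1 p.2}.

Lemma card_corner (N : nat) (o : bool) :
  (0 < N)%N -> #|{: corner N o}| = (N.*2.+2 - o)%N.
Proof.
move=> N_gt0; rewrite card_sig.
have -> : N.*2.+2 = #|{: bool * 'I_N.+1}|.
  by rewrite card_prod card_bool card_ord mul2n doubleS.
have lt1 : (1 < N.+1)%N by [].
case: o; [rewrite subn1 -(cardC1 (true, Ordinal lt1)) | rewrite subn0];
  apply: eq_card => -[p a]; rewrite !inE /is_corner -ltnS ltn_ord //=.
by rewrite xpair_eqE; case: p.
Qed.

Definition point2 (R : realType) (x y : R) : 'rV[R]_2 :=
  \row_j (if j == 0 then x else y).

Definition corner_point (R : realType) (N : nat) (o b : bool)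
    (p : corner N o) : 'rV[R]_2 :=
  let x := (val p).2%:R in let y := corner_height R N o (val p).1 (val p).2 in
  if b then point2 y x else point2 x y.
Arguments corner_point R N o b p : clear implicits.

Lemma dotrv_point2 (R : realType) (c : 'rV[R]_2) (x y : R) :
  dotrv c (point2 x y) = c 0 0 * x + c 0 1 * y.
Proof.
rewrite /dotrv big_ord_recl big_ord1 !mxE /=; congr (_ + c 0 _ * _).
exact: val_inj.
Qed.

Lemma dotrv_corner_point (R : realType) (N : nat) (o b : bool) c
    (p : corner N o) :
  dotrv c (corner_point R N o b p) =
  c 0 (if b then 1 else 0) * (val p).2%:R +
  c 0 (if b then 0 else 1) * corner_height R N o (val p).1 (val p).2.
Proof. by case: b; rewrite dotrv_point2 // addrC. Qed.

Lemma cornerP (N : nat) (o top : bool) (a : nat) :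
  is_corner N o top a ->
  exists p : corner N o, (val p).1 = top /\ (val p).2 = a :> nat.
Proof.
move=> ca; have aN : (a < N.+1)%N by case/andP: ca.
by exists (Sub (top, Ordinal aN) ca).
Qed.

Lemma upper_point_in_hull (R : realType) (N : nat) (o : bool) a :
  (o -> (2 < N)%N) -> (a <= N)%N ->
  convex_hull (range (corner_point R N o false))
    (point2 a%:R (upper_height R N o a)).
Proof.
move=> oN aN.
have corner_in top i : is_corner N o top i ->
  convex_hull (range (corner_point R N o false))
    (point2 i%:R (corner_height R N o top i)).
  move=> /cornerP[p [<- <-]]; apply: convex_hull_sub; by exists p.
rewrite /upper_height; case: ifPn => [/andP[o1 /eqP a1]|oa]; last first.
  by apply: corner_in; rewrite /is_corner aN.
have N3 := oN o1.
have h0 : is_corner N o true 0 by rewrite /is_corner andbF.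
have h2 : is_corner N o true 2 by rewrite /is_corner (ltnW N3) andbF.
have half01 : 0 <= (2^-1 : R) <= 1 by lra.
suff <- : 2^-1 *: point2 0%:R (corner_height R N o true 0) +
    (1 - 2^-1) *: point2 2%:R (corner_height R N o true 2) =
    point2 a%:R (N%:R + 1).
  exact: convex_hull_conv half01 (corner_in _ _ h0) (corner_in _ _ h2).
apply/rowP => j; rewrite !mxE /corner_height o1 a1 /=.
by case: ifP => _; lra.
Qed.

Lemma vertical_segment_in_hull (R : realType) (N : nat) (o : bool) a (y : R) :
  (o -> (2 < N)%N) -> (a <= N)%N ->
  corner_height R N o false a <= y <= upper_height R N o a ->
  convex_hull (range (corner_point R N o false))
    (point2 a%:R y).
Proof.
move=> oN aN /andP[yl yu].
have [p [pt pa]] : exists p : corner N o,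
    (val p).1 = false /\ (val p).2 = a :> nat.
  by apply: cornerP; rewrite /is_corner aN andbF.
have lower : convex_hull (range (corner_point R N o false))
    (point2 a%:R (corner_height R N o false a)).
  by apply: convex_hull_sub; exists p; rewrite // /corner_point pt pa.
have [gap|gap] := ltrP (corner_height R N o false a) (upper_height R N o a);
  last first.
  by have -> : y = corner_height R N o false a by lra.
pose g := upper_height R N o a - corner_height R N o false a.
have g_gt0 : 0 < g by rewrite subr_gt0.
pose l := (y - corner_height R N o false a) / g.
have l01 : 0 <= l <= 1.
  apply/andP; split; first by rewrite divr_ge0 ?subr_ge0 // ltW.
  by rewrite ler_pdivrMr // mul1r lerD2r.
suff -> : point2 a%:R y = l *: point2 a%:R (upper_height R N o a) +
    (1 - l) *: point2 a%:R (corner_height R N o false a).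
  by apply: convex_hull_conv => //; apply: upper_point_in_hull.
apply/rowP => j; rewrite !mxE; case: ifP => _; first by ring.
have : l * g = y - corner_height R N o false a by rewrite /l divfK // gt_eqF.
by rewrite /g; lra.
Qed.

Lemma height_int (R : realType) (N : nat) (o top : bool) a :
  corner_height R N o top a \is a Num.int.
Proof.
have nat k : k%:R \is a @Num.int R by exact: natr_int.
rewrite /corner_height; case: top; last first.
  by apply: rpredM; [apply: rpredM | apply: rpredB].
apply: rpredD; last by case: ifP => _; [exact: nat | exact: rpred0].
by apply: rpredD; [apply: rpred1 | apply: rpredM => //; apply: rpredB].
Qed.

(** Exchanging the coordinates exchanges the two polygons, so that both types of
    slices reduce to [planar_shadow]. *)
Lemma corner_point_shadow (R : realType) (N : nat) (o : bool)
    (b : bool) (x : 'rV[R]_2) (u : R) :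
  (0 < N)%N -> (o -> (2 < N)%N) -> lattice_point x -> u = 0 \/ 1 <= u ->
  let V := corner_point R N o in
  u = 0 /\ convex_hull (range (V b)) x \/
  exists i j, forall c, (forall k, dotrv c (V b k) <= dotrv c (V b i)) ->
    (1 + u) * dotrv c (V b i) <= dotrv c x + u * dotrv c (V (~~ b) j).
Proof.
move=> N_gt0 oN xlat u01 V.
pose X := x 0 (if b then 1 else 0); pose Y := x 0 (if b then 0 else 1).
have [X' XE] : exists z : int, X = z%:~R by apply/intrP; apply: xlat.
have [Y' YE] : exists z : int, Y = z%:~R by apply/intrP; apply: xlat.
have xE : x = if b then point2 Y X else point2 X Y.
  rewrite /X /Y; case: (b); apply/rowP => j; rewrite !mxE;
    by case: ifPn => [/eqP->//|j0]; congr (x 0 _); apply/val_inj;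
       case: j j0 => [[|[]]].
case: (planar_shadow X' Y' N_gt0 oN u01) => [[u0 [a [aN Xa Ya]]]|].
  left; split=> //.
  have := vertical_segment_in_hull oN aN Ya; rewrite -YE.
  have -> : a%:R = X by rewrite XE Xa.
  rewrite xE {xE}; case: (b) => //.
  pose swap (z : 'rV[R]_2) := point2 (z 0 1) (z 0 0).
  have swapE y z : swap (point2 y z) = point2 z y.
    by rewrite /swap !mxE.
  rewrite -[point2 Y X]swapE; apply: convex_hull_image => [y z l|_ [p _ <-]].
    by apply/rowP => j; rewrite !mxE; case: ifP.
  by apply: convex_hull_sub; exists p; rewrite // /V /corner_point swapE.
move=> [top [a [/cornerP[j [<- <-]]]]].
move=> [top' [a' [/cornerP[i [<- <-]] sh]]].
right; exists i, j => c cM.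
have := sh (c 0 (if b then 1 else 0)) (c 0 (if b then 0 else 1)).
have dotE : dotrv c x =
    c 0 (if b then 1 else 0) * X + c 0 (if b then 0 else 1) * Y.
  by rewrite [in LHS]xE; case: (b); rewrite dotrv_point2 // addrC.
rewrite dotE /V !dotrv_corner_point -XE -YE !if_neg => h.
apply: le_trans (h _) _; last by lra.
move=> t k /cornerP[p [<- <-]]; have := cM p.
by rewrite /V !dotrv_corner_point.
Qed.

Theorem theorem5p3 (R : realType) (n d : nat)
    (hn : (3 < n)%N) (hn5 : n <> 5%N) (hd : (4 <= d)%N) :
  exists P : set 'rV[R]_d,
    [/\ lattice_polytope P,
        affine_dim P d,
        vertices P #= `I_(n * 2 ^ (d - 2))%N &
        forall x : 'rV[R]_d, lattice_point x -> ~ insertable P x].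
Proof.
case: d hd => [|[|m]] // _; rewrite !subSS subn0 -[m.+2]/(2 + m)%N.
pose o := odd n.
pose N := if o then n./2 else n./2.-1.
have nE : n = (o + n./2.*2)%N by rewrite odd_double_half.
have [N_gt0 oN nN] : [/\ (0 < N)%N, o -> (2 < N)%N & n = (N.*2.+2 - o)%N].
  by move: nE; rewrite /N; case: (o) => /=; rewrite -!muln2; split; lia.
rewrite {hn hn5 nE}nN -card_corner //.
apply: (@twisted_prism R m (corner N o) (corner_point R N o)).
- move=> b i j; rewrite /corner_point; case: b; rewrite mxE;
    by case: ifP; rewrite ?natr_int ?height_int.
- move=> b i; have [c0 [c1 ex]] := corner_exposed R oN (valP i).
  exists (if b then point2 c1 c0 else point2 c0 c1) => j ji.
  rewrite !dotrv_corner_point; have := ex _ _ (valP j).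
  have -> : (((val j).1, (val j).2 : nat) != ((val i).1, (val i).2 : nat)).
    apply: contra ji; rewrite xpair_eqE => /andP[/eqP e1 /eqP /val_inj e2].
    apply/eqP/val_inj; move: e1 e2.
    by case: (val j); case: (val i) => /= ? ? ? ? -> ->.
  by case: (b); rewrite !mxE /= => /(_ isT).
- by move=> b x u xlat u01; apply: corner_point_shadow.
- move=> b; have [i [it ia]] : exists p : corner N o,
      (val p).1 = false /\ (val p).2 = 0%N :> nat.
    by apply: cornerP; rewrite /is_corner andbF.
  exists i; rewrite /corner_point it ia /corner_height /=.
  by case: b; apply/rowP => j; rewrite !mxE; case: ifP => _; ring.
move=> j; case: (eqVneq j 0) => [->|j0].
  have [i [it ia]] : exists p : corner N o,
      (val p).1 = false /\ (val p).2 = N :> nat.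
    by apply: cornerP; rewrite /is_corner leqnn andbF.
  exists i, N%:R; split; first by rewrite pnatr_eq0 -lt0n.
  rewrite /corner_point it ia /corner_height /=.
  by apply/rowP => k; rewrite !mxE /=; case: (k == 0); rewrite /=; ring.
have [i [it ia]] : exists p : corner N o,
    (val p).1 = true /\ (val p).2 = 0%N :> nat.
  by apply: cornerP; rewrite /is_corner andbF.
exists i, (corner_height R N o true 0); split.
  by apply: lt0r_neq0; rewrite /corner_height eqxx andbT; case: (o); lra.
rewrite /corner_point it ia; apply/rowP => k; rewrite !mxE /=.
have -> : (k == j) = (k != 0).
  apply/eqP/idP => [->//|]; move: j0.
  by case: k => [[|[]]] //; case: j => [[|[]]] // *; apply: val_inj.
by case: (k == 0); rewrite /=; ring.
Qed.
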